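(* Let $\mathbf x=(x_1,\ldots,x_7)\in\mathbb C^7$. Then $\mathbf x\in G_{E(3;3;1,1,1)}$ if and only if (1) holds; likewise if and only if (2) holds; likewise if and only if (3) holds, where (each condition including that the denominators involved do not vanish): (1) $\left(\frac{x_2-z_1x_3}{1-x_1z_1},\frac{x_4-z_1x_5}{1-x_1z_1},\frac{x_6-z_1x_7}{1-x_1z_1}\right)\in G_{E(2;2;1,1)}$ for all $z_1\in\bar{\mathbb D}$; (2) $\left(\frac{x_1-z_2x_3}{1-x_2z_2},\frac{x_4-z_2x_6}{1-x_2z_2},\frac{x_5-z_2x_7}{1-x_2z_2}\right)\in G_{E(2;2;1,1)}$ for all $z_2\in\bar{\mathbb D}$; (3) $\left(\frac{x_1-z_3x_5}{1-x_4z_3},\frac{x_2-z_3x_6}{1-x_4z_3},\frac{x_3-z_3x_7}{1-x_4z_3}\right)\in G_{E(2;2;1,1)}$ for all $z_3\in\bar{\mathbb D}$.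
   Context: $\bar{\mathbb D}$ is the closed unit disc. For a linear subspace $E$ of $\mathcal M_{n\times n}(\mathbb C)$, $\mu_E(A)=1/\inf\{\|X\|: X\in E,\ \det(I-AX)=0\}$, with $\mu_E(A)=0$ if $I-AX$ is nonsingular for all $X\in E$ (operator norm). $E(2;2;1,1)$ is the space of $2\times2$ diagonal matrices and $E(3;3;1,1,1)$ the space of $3\times 3$ diagonal matrices. $G_{E(2;2;1,1)}=\{(a_{11},a_{22},\det A): A\in\mathcal M_{2\times2}(\mathbb C),\ \mu_{E(2;2;1,1)}(A)<1\}$ (the tetrablock). $G_{E(3;3;1,1,1)}=\{\pi(A): A\in\mathcal M_{3\times3}(\mathbb C),\ \mu_{E(3;3;1,1,1)}(A)<1\}$ where $$\pi(A)=\big(a_{11},\ a_{22},\ a_{11}a_{22}-a_{12}a_{21},\ a_{33},\ a_{11}a_{33}-a_{13}a_{31},\ a_{22}a_{33}-a_{23}a_{32},\ \det A\big).$$ *)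

(* Defs.v *)
From mathcomp Require Import all_boot all_order all_algebra.
From mathcomp Require Import boolp classical_sets reals.
From mathcomp Require Import complex.

Set Implicit Arguments.
Unset Strict Implicit.
Unset Printing Implicit Defensive.

Import Order.TTheory GRing.Theory Num.Theory ComplexField.

Local Open Scope classical_set_scope.
Local Open Scope complex_scope.
Local Open Scope ring_scope.

Section Mu.
Variables (R : realType) (n : nat).
Implicit Types (A X : 'M[R[i]]_n) (E : {vspace 'M[R[i]]_n}).

Definition enorm (v : 'cV[R[i]]_n) : R :=
  Num.sqrt (\sum_k Normc.normc (v k 0) ^+ 2).

Definition opnorm X : R :=
  sup [set enorm (X *m v) | v in [set v | enorm v <= 1]].

Definition singularizers E A : set 'M[R[i]]_n :=
  [set X | X \in E /\ \det (1%:M - A *m X) = 0].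

(* The infimum is positive whenever the set is nonempty, since
   \det (1 - A X) = 0 forces opnorm A * opnorm X >= 1, so the inverse below
   is never taken at 0. *)
Definition mu E A : R :=
  if `[< singularizers E A !=set0 >]
  then (inf [set opnorm X | X in singularizers E A])^-1
  else 0.

Definition diag_vs : {vspace 'M[R[i]]_n} := limg (linfun (@diag_mx R[i] n)).

Lemma mem_diag_vs X : (X \in diag_vs) = is_diag_mx X.
Proof.
apply/idP/idP => [/memv_imgP[d _ ->]|/is_diag_mxP dX].
  by rewrite lfunE; exact: diag_mx_is_diag.
apply/memv_imgP; exists (\row_j X j j); rewrite ?memvf// lfunE /=.
apply/matrixP => j k; rewrite !mxE.
have [<-|jk] := eqVneq j k; first by rewrite mulr1n.
by rewrite mulr0n dX.
Qed.

End Mu.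

Section Domains.
Variable R : realType.

(* Matrix indices start at 0: the entry a_(j+1)(k+1) is A j k. *)

Definition pi2 (A : 'M[R[i]]_2) : 3.-tuple R[i] :=
  [tuple A 0 0; A 1 1; \det A].

Definition pi3 (A : 'M[R[i]]_3) : 7.-tuple R[i] :=
  [tuple A 0 0;
         A 1 1;
         A 0 0 * A 1 1 - A 0 1 * A 1 0;
         A 2 2;
         A 0 0 * A 2 2 - A 0 2 * A 2 0;
         A 1 1 * A 2 2 - A 1 2 * A 2 1;
         \det A].

Definition G2 : set (3.-tuple R[i]) :=
  [set pi2 A | A in [set A | mu (diag_vs R 2) A < 1]].

Definition G3 : set (7.-tuple R[i]) :=
  [set pi3 A | A in [set A | mu (diag_vs R 3) A < 1]].

End Domains.

(* Main.v *)
Require Import Defs.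
From mathcomp Require Import all_boot all_order all_algebra.
From mathcomp Require Import boolp classical_sets reals topology normedtype.
From mathcomp Require Import complex perm ring lra.
Import Order.TTheory GRing.Theory Num.Theory ComplexField.
Import numFieldTopology.Exports numFieldNormedType.Exports.
Local Open Scope classical_set_scope.
Local Open Scope complex_scope.
Local Open Scope ring_scope.

(* Both domains are complements of zero loci: [mu_E(A) < 1] for the diagonal
   space [E] says that [det (1 - A diag(z))] does not vanish on the closed unit
   polydisc, compactness being what turns "no zero of norm at most 1" into "the
   norms of the zeros are bounded below by some r > 1".  This determinant is a
   multi-affine polynomial in [z] with coefficients the entries of [pi(A)], and
   [pi] is onto, so membership in [G2] and [G3] is nonvanishing of
   [1 - y1 z1 - y2 z2 + y3 z1 z2] and of its three-variable analogue.  Dividing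
   the latter by its value [1 - x1 z1] at [z2 = z3 = 0] gives a polynomial of
   the former kind in [(z2, z3)], and likewise for the other two variables. *)

(** * Determinants of order two and three, and the pencil [1 - A diag(z)] *)

Lemma det_mx2 (K : comPzRingType) (A : 'M[K]_2) :
  \det A = A 0 0 * A 1 1 - A 0 1 * A 1 0.
Proof.
rewrite (expand_det_row _ 0) !big_ord_recl big_ord0 /cofactor !det_mx11 !mxE /=.
have -> : lift 0 (0 : 'I_1) = 1 :> 'I_2 by exact: val_inj.
have -> : lift 1 (0 : 'I_1) = 0 :> 'I_2 by exact: val_inj.
by rewrite /=; ring.
Qed.

Lemma det_mx3 (K : comPzRingType) (A : 'M[K]_3) :
  \det A = A 0 0 * (A 1 1 * A 2 2 - A 1 2 * A 2 1)
         - A 0 1 * (A 1 0 * A 2 2 - A 1 2 * A 2 0)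
         + A 0 2 * (A 1 0 * A 2 1 - A 1 1 * A 2 0).
Proof.
rewrite (expand_det_row _ 0) !big_ord_recl big_ord0 /cofactor !det_mx2 !mxE /=.
have e01 : lift 0 (0 : 'I_2) = 1 :> 'I_3 by exact: val_inj.
have e02 : lift 0 (1 : 'I_2) = 2 :> 'I_3 by exact: val_inj.
have e10 : lift 1 (0 : 'I_2) = 0 :> 'I_3 by exact: val_inj.
have e12 : lift 1 (1 : 'I_2) = 2 :> 'I_3 by exact: val_inj.
have e20 : lift 2 (0 : 'I_2) = 0 :> 'I_3 by exact: val_inj.
have e21 : lift 2 (1 : 'I_2) = 1 :> 'I_3 by exact: val_inj.
have -> : lift 0 (0 : 'I_1) = 1 :> 'I_2 by exact: val_inj.
by rewrite e01 e02 e10 e12 e20 e21 /bump /=; ring.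
Qed.

Lemma det_pencil2 (K : comPzRingType) (A : 'M[K]_2) z :
  \det (1%:M - A *m diag_mx z) =
  1 - A 0 0 * z 0 0 - A 1 1 * z 0 1 + \det A * z 0 0 * z 0 1.
Proof. by rewrite !det_mx2 mul_mx_diag !mxE /=; ring. Qed.

Lemma det_pencil3 (K : comPzRingType) (A : 'M[K]_3) z :
  \det (1%:M - A *m diag_mx z) =
  1 - A 0 0 * z 0 0 - A 1 1 * z 0 1
  + (A 0 0 * A 1 1 - A 0 1 * A 1 0) * z 0 0 * z 0 1
  - A 2 2 * z 0 2 + (A 0 0 * A 2 2 - A 0 2 * A 2 0) * z 0 0 * z 0 2
  + (A 1 1 * A 2 2 - A 1 2 * A 2 1) * z 0 1 * z 0 2
  - \det A * z 0 0 * z 0 1 * z 0 2.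
Proof. by rewrite !det_mx3 mul_mx_diag !mxE /=; ring. Qed.

Lemma det_pencil_continuous (K : numFieldType) n (A : 'M[K]_n) :
  continuous (fun z : 'rV[K]_n => \det (1%:M - A *m diag_mx z)).
Proof.
have entry j k : continuous (fun z : 'rV[K]_n => (1%:M - A *m diag_mx z) j k).
  have -> : (fun z : 'rV[K]_n => (1%:M - A *m diag_mx z) j k) =
      (fun z => (j == k)%:R - A j k * z 0 k).
    by apply/funext => z; rewrite mul_mx_diag !mxE.
  move=> z; apply: (@cvgB _ _ _ (nbhs z)); first exact: cvg_cst.
  by apply: (@cvgM _ _ (nbhs z)); [exact: cvg_cst|exact: coord_continuous].
(* The Leibniz expansion: a sum over permutations [s] of signed products of entries, each entry
   being affine in [z]. *)
apply: continuous_big => [|s _ z]; first exact: add_continuous.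
apply: (@cvgM _ _ (nbhs z)); first exact: cvg_cst.
by apply: continuous_big => [|j _]; [exact: mul_continuous|exact: entry].
Qed.

(** * Compactness and the enlargement of a polydisc *)

Section Polydisc.
Variable R : realType.
(* The topology is attached to [numFieldType], hence the ascription. *)
Local Notation C := (R[i] : numFieldType).

Lemma real_complex_continuous : continuous (fun x : R => x%:C : C).
Proof.
move=> x; apply/cvgrPdist_lt => /= e e0.
have [r re r0] : exists2 r : R, e = r%:C & 0 < r.
  have /complex_realP[r re] : e \is Num.real by exact: gtr0_real.
  by exists r => //; move: e0; rewrite re ltcR.
near=> y; rewrite -rmorphB /= normc_def /= expr0n addr0 sqrtr_sqr re ltcR.
near: y; apply: cvgr_dist_lt => //; exact: cvg_id.
Unshelve. all: by end_near. Qed.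

Lemma compact_square (r : R) :
  compact [set z : C | `|complex.Re z| <= r /\ `|complex.Im z| <= r].
Proof.
pose g (p : R * R) : C := p.1%:C + 'i * p.2%:C.
suff -> : [set z : C | `|complex.Re z| <= r /\ `|complex.Im z| <= r]
    = g @` (`[- r, r] `*` `[- r, r]).
  apply: continuous_compact; last by apply: compact_setX; exact: segment_compact.
  apply: continuous_subspaceT => p; apply: cvgD.
    by apply: (@cvg_comp _ _ _ fst (fun x : R => x%:C : C));
      [exact: cvg_fst | exact: real_complex_continuous].
  apply: cvgM; first exact: cvg_cst.
  by apply: (@cvg_comp _ _ _ snd (fun x : R => x%:C : C));
      [exact: cvg_snd | exact: real_complex_continuous].
apply/seteqP; split => [z [rez imz]|_ [[a b] /= [+ +] <-]].
  exists (complex.Re z, complex.Im z); last by rewrite /g /= -complexE.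
  by split; rewrite /= in_itv /= -ler_norml.
by rewrite /= !in_itv /= -!ler_norml /g /=; simpc.
Qed.

(** A zero of [f] has a coordinate of modulus greater than [rho], and this excess persists nearby.
    Compactness of [K], which contains every polydisc of radius below [rho + 1], makes the excess
    uniform. *)
Lemma polydisc_nonvanishing_enlarge n (rho : R) (f : 'rV[C]_n -> C) :
  continuous f ->
  (forall z : 'rV[C]_n, (forall j, `|z 0 j| <= rho%:C) -> f z != 0) ->
  exists2 r : R, rho < r &
    forall z : 'rV[C]_n, (forall j, `|z 0 j| <= r%:C) -> f z != 0.
Proof.
move=> cf f0.
pose K := [set z : 'rV[C]_n | forall j,
  `|complex.Re (z 0 j)| <= rho + 1 /\ `|complex.Im (z 0 j)| <= rho + 1].
have cK : near_covering K.
  apply/compact_near_coveringP.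
  apply: (@rV_compact C n (fun=> [set z : C |
    `|complex.Re z| <= rho + 1 /\ `|complex.Im z| <= rho + 1])) => j.
  exact: compact_square.
pose P (r : R) (z : 'rV[C]_n) :=
  f z != 0 \/ exists j, r%:C < `|z 0 j|.
(* [P r] holds locally in [z] for all [r] close enough to [rho], hence on the
   whole compact set [K] for some common [r > rho]. *)
have : \forall r \near rho^'+, K `<=` P r.
  apply: (cK R rho^'+ P) => z _; have [fz|fz] := pselect (f z != 0).
    have fz' : \forall z' \near z, f z' != 0 by exact: cvgr_neq0 (cf z) fz.
    by near=> z' r; left => /=; exact: (near fz' z').
  have [j zj] : exists j, rho%:C < `|z 0 j|.
    apply: contrapT => /forallNP zle; apply: fz; apply: f0 => j.
    by rewrite real_leNgt ?normr_real//; [exact/negP|apply/complex_realP; exists rho].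
  have [s [ss rs]] : exists s : R, s%:C = `|z 0 j| /\ rho < s.
    have /complex_realP[s se] := normr_real (z 0 j).
    by exists s; move: zj; rewrite se ltcR.
  (* The midpoint of [rho] and [s] separates the moduli near [z] from the radii near [rho]. *)
  have zs : \forall z' \near z, ((rho + s) / 2)%:C < `|(z' : 'rV[C]_n) 0 j|.
    apply: (@cvgr_norm_gt C C _ (nbhs z) _ (fun z' : 'rV[C]_n => z' 0 j) (z 0 j)).
      exact: (@coord_continuous C 1 n 0 j z).
    by rewrite -ss ltcR; lra.
  have rs' : \forall r \near rho^'+, r < (rho + s) / 2.
    by apply: nbhs_right_lt; lra.
  near=> z' r; right; exists j => /=.
  by apply: lt_trans (near zs z' _) => //; rewrite ltcR; exact: (near rs' r).
move=> KP.
have [r [rhor rrho Pr]] : exists r, [/\ rho < r, r < rho + 1 & K `<=` P r].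
  apply: (@filter_ex _ rho^'+).
  by near=> r; split; near: r; [exact: nbhs_right_gt|apply: nbhs_right_lt; lra|].
exists r => // z zr; have [|//|[j]] := Pr z.
  move=> j; split; rewrite -lecR.
    apply: le_trans (normc_ge_Re _) _; apply: le_trans (zr j) _.
    by rewrite lecR ltW.
  (* Multiplication by [i] turns the imaginary part into a real part, up to sign. *)
  have /= := normc_ge_Re (z 0 j * 'i%C).
  rewrite ReiNIm normrN normrM normCi mulr1 => /le_trans; apply.
  apply: le_trans (zr j) _.
  by rewrite lecR ltW.
by move=> /lt_le_trans /(_ (zr j)); rewrite ltxx.
Unshelve. all: by end_near. Qed.

End Polydisc.

(** * Operator norms of diagonal matrices, and [mu] for the diagonal space *)

Section OpnormDiag.
Variables (R : realType) (n : nat).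
Implicit Types (z : 'rV[R[i]]_n) (v : 'cV[R[i]]_n).

Lemma normr_normc (x : R[i]) : `|x| = (Normc.normc x)%:C.
Proof. by []. Qed.

Lemma normc_ge0 (x : R[i]) : 0 <= Normc.normc x.
Proof. by rewrite -lecR; exact: (normr_ge0 x). Qed.

Lemma diag_mulE z v k : (diag_mx z *m v) k 0 = z 0 k * v k 0.
Proof. by rewrite mul_diag_mx mxE. Qed.

Lemma enorm_diag_le z v (r : R) : 0 <= r ->
  (forall j, Normc.normc (z 0 j) <= r) ->
  enorm (diag_mx z *m v) <= r * enorm v.
Proof.
move=> r0 zr; rewrite -(ger0_norm r0) -sqrtr_sqr -sqrtrM ?sqr_ge0//.
rewrite /enorm ler_wsqrtr//.
rewrite mulr_sumr; apply: ler_sum => k _.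
rewrite diag_mulE Normc.normcM exprMn; apply: ler_pM; rewrite ?sqr_ge0//.
by rewrite ler_pXn2r ?nnegrE ?normc_ge0.
Qed.

Lemma enorm_delta (k : 'I_n) (a : R[i]) :
  enorm (a *: delta_mx k 0) = Normc.normc a.
Proof.
rewrite /enorm (bigD1 k)//= big1 => [|j jk].
  by rewrite !mxE !eqxx mulr1 addr0 sqrtr_sqr ger0_norm ?normc_ge0.
by rewrite !mxE (negPf jk) mulr0 Normc.normc0 expr0n.
Qed.

Lemma opnorm_diag_le z (r : R) : 0 <= r ->
  (forall j, Normc.normc (z 0 j) <= r) -> opnorm (diag_mx z) <= r.
Proof.
move=> r0 zr; apply: ge_sup.
  (* A supremum is controlled by an upper bound only for a nonempty set; the zero vector is a
     witness. *)
  exists (enorm (diag_mx z *m 0)), 0 => //=; rewrite /enorm big1 ?sqrtr0 ?ler01//.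
  by move=> k _; rewrite mxE Normc.normc0 expr0n.
move=> _ [v /= v1 <-]; apply: le_trans (enorm_diag_le _ v _ r0 zr) _.
by rewrite ler_piMr.
Qed.

Lemma le_opnorm_diag z k : Normc.normc (z 0 k) <= opnorm (diag_mx z).
Proof.
apply: ub_le_sup.
  (* A crude bound, needed only for the supremum to be finite. The basis vector below then realizes
     the modulus of [z 0 k]. *)
  pose M := \sum_j Normc.normc (z 0 j).
  have zM j : Normc.normc (z 0 j) <= M.
    by rewrite /M (bigD1 j)//= lerDl sumr_ge0// => *; exact: normc_ge0.
  have M0 : 0 <= M by apply: sumr_ge0 => *; exact: normc_ge0.
  exists M => _ [v /= v1 <-]; apply: le_trans (enorm_diag_le _ v _ M0 zM) _.
  by rewrite ler_piMr.
exists (delta_mx k 0).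
  by rewrite /= -[delta_mx _ _]scale1r enorm_delta Normc.normc1.
rewrite -(enorm_delta k); congr enorm; apply/matrixP => i j.
rewrite (ord1 j) diag_mulE !mxE eqxx andbT.
by have [->//|_] := eqVneq i k; rewrite !mulr0.
Qed.

Lemma singularizers_diagP (A X : 'M[R[i]]_n) :
  singularizers (diag_vs R n) A X <->
  exists2 z, X = diag_mx z & \det (1%:M - A *m diag_mx z) = 0.
Proof.
rewrite /singularizers /= mem_diag_vs; split=> [[/diag_mxP[z ->] ?]|[z -> ?]].
  by exists z.
by split=> //; exact: diag_mx_is_diag.
Qed.

(** The operator norm of [diag_mx z] is the largest modulus among the entries of [z], so
    singularizers of norm at most 1 are zeros in the closed unit polydisc. Excluding these pointwise
    would only give an infimum at least 1; [lb_gt] makes the inequality strict. *)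
Lemma mu_diag_lt1P (A : 'M[R[i]]_n) :
  mu (diag_vs R n) A < 1 <->
  forall z, (forall j, `|z 0 j| <= 1) -> \det (1%:M - A *m diag_mx z) != 0.
Proof.
pose S := singularizers (diag_vs R n) A.
have lb_gt (rho : R) : (forall z, (forall j, `|z 0 j| <= rho%:C) ->
      \det (1%:M - A *m diag_mx z) != 0) ->
    exists2 r, rho < r & lbound [set opnorm X | X in S] r.
  have cA := @det_pencil_continuous (R[i] : numFieldType) n A.
  move=> /(polydisc_nonvanishing_enlarge _ _ _ _ cA)[r rhor f0].
  exists r => // _ [Y /singularizers_diagP[z -> fz] <-].
  have [j zj] : exists j, r < Normc.normc (z 0 j).
    apply: contrapT => /forallNP zle; suff : false by [].
    have := f0 z; rewrite fz eqxx; apply=> j.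
    by rewrite normr_normc lecR leNgt; exact/negP.
  exact: ltW (lt_le_trans zj (le_opnorm_diag z j)).
(* Without singularizers [mu] has its default value 0, and both sides hold. *)
rewrite /mu -/S; case: asboolP => [S0|nS]; last first.
  split=> [_ z zle|_]; last exact: ltr01.
  by apply/eqP => fz; apply: nS; exists (diag_mx z); apply/singularizers_diagP; exists z.
(* Radius 0: the determinant is 1 at the origin. Hence the infimum is positive and its inverse can
   be compared with 1. *)
have [r r0 Sr] : exists2 r, 0 < r & lbound [set opnorm X | X in S] r.
  apply: lb_gt => z z0; suff -> : z = 0.
    by rewrite linear0 mulmx0 subr0 det1 oner_neq0.
  apply/matrixP => i j; rewrite (ord1 i) mxE; apply/eqP.
  by rewrite -normr_le0; exact: z0.
have T0 : [set opnorm X | X in S] !=set0 by case: S0 => X SX; exists (opnorm X), X.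
have infS0 : 0 < inf [set opnorm X | X in S] := lt_le_trans r0 (lb_le_inf T0 Sr).
rewrite invf_lt1//; split=> [inf1 z zle|/lb_gt[s s1 Ss]].
  apply/eqP => fz.
  suff : inf [set opnorm X | X in S] <= 1 by rewrite leNgt inf1.
  apply: (@le_trans _ _ (opnorm (diag_mx z))).
    apply: ge_inf; first by exists r.
    by exists (diag_mx z) => //; apply/singularizers_diagP; exists z.
  by apply: opnorm_diag_le => // j; rewrite -lecR -normr_normc.
exact: lt_le_trans s1 (lb_le_inf T0 Ss).
Qed.

End OpnormDiag.

(** * Solving for the off-diagonal entries of a matrix *)

Section Representation.
Variable K : numClosedFieldType.

(** These are the roots of [T^2 - s T + p]; [d] is a square root of its discriminant. *)
Lemma exists_sum_prod (s p : K) : exists u v, u + v = s /\ u * v = p.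
Proof.
pose d := sqrtC (s ^+ 2 - 4 * p).
have dE : d ^+ 2 = s ^+ 2 - 4 * p by exact: sqrtCK.
exists ((s + d) / 2), ((s - d) / 2); split; first by field.
have -> : (s + d) / 2 * ((s - d) / 2) = (s ^+ 2 - d ^+ 2) / 4 by field.
by rewrite dE; field.
Qed.

(* [p], [q], [r] are the prescribed products of opposite off-diagonal entries,
   [u] and [v] the two cyclic products occurring in a 3x3 determinant. *)
Lemma exists_offdiag (p q r u v : K) : u * v = p * q * r ->
  exists a12 a21 a13 a31 a23 a32,
    [/\ a12 * a21 = p, a13 * a31 = q, a23 * a32 = r,
        a12 * a23 * a31 = u & a13 * a21 * a32 = v].
Proof.
move=> uv; have [u0|u0] := eqVneq u 0; last first.
  exists 1, p, (q / u), u, 1, r; split; try by field.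
  by apply: (mulfI u0); rewrite uv; field.
have [v0|v0] := eqVneq v 0; last first.
  exists p, 1, v, (q / v), r, 1; split; try by field.
  by apply: (mulIf v0); rewrite uv; field.
(* Now [p * q * r = 0]. Setting both entries of a pair with zero product to 0 kills both cyclic
   products, since each contains one entry of every pair. *)
have /eqP := uv; rewrite u0 v0 mul0r eq_sym !mulf_eq0 -orbA => /or3P[] /eqP ->.
- by exists 0, 0, q, 1, r, 1; split; ring.
- by exists p, 1, 0, 0, r, 1; split; ring.
- by exists p, 1, q, 1, 0, 0; split; ring.
Qed.

End Representation.

(** * Surjectivity of [pi2] and [pi3], and the domains as nonvanishing conditions *)

Section Characterization.
Variable R : realType.
Local Notation C := R[i].

Lemma pi2_surj (y1 y2 y3 : C) : exists A, pi2 A = [tuple y1; y2; y3].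
Proof.
exists (\matrix_(i, j) (nth [::] [:: [:: y1; y1 * y2 - y3]; [:: 1; y2]] i)`_j).
by apply: val_inj; rewrite /= det_mx2 !mxE /=; do 3?congr cons; ring.
Qed.

(** The diagonal and the principal minors force [p], [q], [r]. The determinant then prescribes only
    the sum of the two cyclic products, whose product must be [p * q * r]. *)
Lemma pi3_surj (x1 x2 x3 x4 x5 x6 x7 : C) :
  exists A, pi3 A = [tuple x1; x2; x3; x4; x5; x6; x7].
Proof.
pose p := x1 * x2 - x3; pose q := x1 * x4 - x5; pose r := x2 * x4 - x6.
have [u [v [suv puv]]] := exists_sum_prod _
  (x7 - x1 * x2 * x4 + x1 * r + x2 * q + x4 * p) (p * q * r).
have [a12 [a21 [a13 [a31 [a23 [a32 [pE qE rE uE vE]]]]]]] :=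
  exists_offdiag _ _ _ _ _ _ puv.
exists (\matrix_(i, j)
  (nth [::] [:: [:: x1; a12; a13]; [:: a21; x2; a23]; [:: a31; a32; x4]] i)`_j).
apply: val_inj; rewrite /= det_mx3 !mxE /=; congr [:: _; _; _; _; _; _; _].
- by rewrite pE /p; ring.
- by rewrite qE /q; ring.
- by rewrite rE /r; ring.
transitivity (x1 * x2 * x4 - x1 * (a23 * a32) - x2 * (a13 * a31)
  - x4 * (a12 * a21) + (a12 * a23 * a31 + a13 * a21 * a32)); first by ring.
by rewrite pE qE rE uE vE suv; ring.
Qed.

Lemma G2P (y1 y2 y3 : C) : G2 [tuple y1; y2; y3] <->
  forall z1 z2 : C, `|z1| <= 1 -> `|z2| <= 1 ->
    1 - y1 * z1 - y2 * z2 + y3 * z1 * z2 != 0.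
Proof.
split=> [[A /mu_diag_lt1P mA /(congr1 val)[<- <- <-]] z1 z2 z1le z2le|P0].
  have := mA (\row_j [:: z1; z2]`_j); rewrite det_pencil2 !mxE; apply=> j.
  by rewrite mxE; case: j => -[|[]].
have [A pA] := pi2_surj y1 y2 y3.
exists A => //; apply/mu_diag_lt1P => z zle.
by move: pA => /(congr1 val)[yE1 yE2 yE3]; rewrite det_pencil2 yE1 yE2 yE3 P0.
Qed.

Lemma G3P (x1 x2 x3 x4 x5 x6 x7 : C) :
  G3 [tuple x1; x2; x3; x4; x5; x6; x7] <->
  forall z1 z2 z3 : C, `|z1| <= 1 -> `|z2| <= 1 -> `|z3| <= 1 ->
    1 - x1 * z1 - x2 * z2 + x3 * z1 * z2 - x4 * z3 + x5 * z1 * z3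
      + x6 * z2 * z3 - x7 * z1 * z2 * z3 != 0.
Proof.
split=> [[A /mu_diag_lt1P mA /(congr1 val)[<- <- <- <- <- <- <-]] z1 z2 z3 z1le z2le z3le|P0].
  have := mA (\row_j [:: z1; z2; z3]`_j); rewrite det_pencil3 !mxE; apply=> j.
  by rewrite mxE; case: j => -[|[|[]]].
have [A pA] := pi3_surj x1 x2 x3 x4 x5 x6 x7.
exists A => //; apply/mu_diag_lt1P => z zle.
move: pA => /(congr1 val)[E1 E2 E3 E4 E5 E6 E7].
by rewrite det_pencil3 E3 E5 E6 E7 E1 E2 E4 P0.
Qed.

(** Clears the common denominator in [G2P]. *)
Lemma G2_divP (d a b c : C) : d != 0 ->
  G2 [tuple a / d; b / d; c / d] <->
  forall z1 z2 : C, `|z1| <= 1 -> `|z2| <= 1 ->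
    d - a * z1 - b * z2 + c * z1 * z2 != 0.
Proof.
move=> d0; rewrite G2P.
have E z1 z2 : d - a * z1 - b * z2 + c * z1 * z2 =
    d * (1 - a / d * z1 - b / d * z2 + c / d * z1 * z2) by field.
by split=> H z1 z2 z1le z2le; have := H _ _ z1le z2le; rewrite E mulf_eq0 (negPf d0).
Qed.

End Characterization.

Theorem theorem2p5 (R : realType) (x1 x2 x3 x4 x5 x6 x7 : R[i]) :
  (G3 [tuple x1; x2; x3; x4; x5; x6; x7] <->
   forall z1 : R[i], `|z1| <= 1 ->
     1 - x1 * z1 != 0 /\
     G2 [tuple (x2 - z1 * x3) / (1 - x1 * z1);
               (x4 - z1 * x5) / (1 - x1 * z1);
               (x6 - z1 * x7) / (1 - x1 * z1)]) /\
  (G3 [tuple x1; x2; x3; x4; x5; x6; x7] <->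
   forall z2 : R[i], `|z2| <= 1 ->
     1 - x2 * z2 != 0 /\
     G2 [tuple (x1 - z2 * x3) / (1 - x2 * z2);
               (x4 - z2 * x6) / (1 - x2 * z2);
               (x5 - z2 * x7) / (1 - x2 * z2)]) /\
  (G3 [tuple x1; x2; x3; x4; x5; x6; x7] <->
   forall z3 : R[i], `|z3| <= 1 ->
     1 - x4 * z3 != 0 /\
     G2 [tuple (x1 - z3 * x5) / (1 - x4 * z3);
               (x2 - z3 * x6) / (1 - x4 * z3);
               (x3 - z3 * x7) / (1 - x4 * z3)]).
Proof.
(* Zero is an admissible value for the other two variables; there the polynomial reduces to the
   denominator. *)
have n0 : `|0 : R[i]| <= 1 by rewrite normr0 ler01.
rewrite !G3P; split; [|split]; split.
- move=> P0 z1 z1le; have d0 : 1 - x1 * z1 != 0.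
    by have := P0 _ _ _ z1le n0 n0; congr (_ != 0); ring.
  split=> //; apply/G2_divP => // z2 z3 z2le z3le.
  by have := P0 _ _ _ z1le z2le z3le; congr (_ != 0); ring.
- move=> H z1 z2 z3 z1le z2le z3le; have [d0 /(G2_divP _ _ _ _ _ d0) T] := H _ z1le.
  by have := T _ _ z2le z3le; congr (_ != 0); ring.
- move=> P0 z2 z2le; have d0 : 1 - x2 * z2 != 0.
    by have := P0 _ _ _ n0 z2le n0; congr (_ != 0); ring.
  split=> //; apply/G2_divP => // z1 z3 z1le z3le.
  by have := P0 _ _ _ z1le z2le z3le; congr (_ != 0); ring.
- move=> H z1 z2 z3 z1le z2le z3le; have [d0 /(G2_divP _ _ _ _ _ d0) T] := H _ z2le.
  by have := T _ _ z1le z3le; congr (_ != 0); ring.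
- move=> P0 z3 z3le; have d0 : 1 - x4 * z3 != 0.
    by have := P0 _ _ _ n0 n0 z3le; congr (_ != 0); ring.
  split=> //; apply/G2_divP => // z1 z2 z1le z2le.
  by have := P0 _ _ _ z1le z2le z3le; congr (_ != 0); ring.
- move=> H z1 z2 z3 z1le z2le z3le; have [d0 /(G2_divP _ _ _ _ _ d0) T] := H _ z3le.
  by have := T _ _ z1le z2le; congr (_ != 0); ring.
Qed.
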